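(* Consider one-dimensional Internal Diffusion Limited Aggregation on $\mathbb{Z}$, defined as follows. Initially the set of occupied sites is $\{0\}$. Particles are released one at a time at the origin; each particle performs a simple symmetric random walk on $\mathbb{Z}$ (each step is determined by a fair coin toss: $+1$ or $-1$ with probability $\tfrac12$ each, independently) until it first reaches an unoccupied site, at which point it stops, that site becomes occupied, and the next particle is released at the origin. For $n \ge 1$ let $E_n$ denote the expected total number of coin tosses (random walk steps, summed over all particles) needed until there are $n$ occupied sites. Then for every $n \geq 1$, \[ E_n = \frac{1}{12} n^3 + \frac{1}{12} n^2. \]
   Formalization: The formula is proved for every n ≥ 2 rather than n ≥ 1: at n = 1 one site is occupied from the start, so E_1 = 0, while the formula would give 1/6. *)

(* Defs.v *)
From HB Require Import structures.
From mathcomp Require Import all_boot all_order all_algebra finmap.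
From mathcomp Require Import all_classical all_reals all_analysis.

Set Implicit Arguments.
Unset Strict Implicit.
Unset Printing Implicit Defensive.

Import Order.TTheory GRing.Theory Num.Theory.
Local Open Scope classical_set_scope.
Local Open Scope ring_scope.

Definition mutually_independent (d d' : measure_display) (T : measurableType d)
    (T' : measurableType d') (R : realType) (P : probability T R) (I : choiceType)
    (X : I -> {RV P >-> T'}) : Prop :=
  forall (J : {fset I}) (B : I -> set T'), (forall i, measurable (B i)) ->
    P (\bigcap_(i in [set` J]) (X i @^-1` B i)) =
      (\prod_(i <- J) P (X i @^-1` B i))%E.

Definition fair_coin_tosses (d : measure_display) (T : measurableType d)
    (R : realType) (P : probability T R) (X : nat -> {RV P >-> bool}) : Prop :=
  mutually_independent X /\
  forall k, P (X k @^-1` [set true]) = (2^-1)%:E.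

Record idla_state := IdlaState {
  occupied : {fset int};
  position : int (* of the particle currently walking *) }.

Definition idla_init : idla_state := IdlaState [fset 0%Z]%fset 0.

(* One coin toss ([true] is a step [+1]).  A particle reaching an unoccupied
   site settles there and the next particle is released at the origin. *)
Definition idla_step (s : idla_state) (b : bool) : idla_state :=
  let x := position s + (if b then 1 else -1) in
  if x \in occupied s then IdlaState (occupied s) x
  else IdlaState (x |` occupied s)%fset 0.

(* The particles use up, one after the other, a single sequence of tosses:
   [idla w t] is the configuration after the first [t] tosses. *)
Fixpoint idla (w : nat -> bool) (t : nat) : idla_state :=
  if t is t'.+1 then idla_step (idla w t') (w t') else idla_init.

(* Equal to [+oo] when [n] occupied sites are never reached; this is why the
   expectation below is an integral of an extended-real function rather
   than an instance of ['E_P[_]]. *)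
Definition tosses_until (R : realType) (n : nat) (w : nat -> bool) : \bar R :=
  ereal_inf [set t%:R%:E | t in [set t | #|` occupied (idla w t)| = n]].

Definition expected_tosses (d : measure_display) (T : measurableType d)
    (R : realType) (P : probability T R) (X : nat -> {RV P >-> bool})
    (n : nat) : \bar R :=
  (\int[P]_w tosses_until R n (fun k => X k w))%E.

(* The closed formula for the expectation is 1/6 at [n = 1], so it cannot hold
   there. *)
Lemma expected_tosses1 (d : measure_display) (T : measurableType d)
    (R : realType) (P : probability T R) (X : nat -> {RV P >-> bool}) :
  expected_tosses X 1 = 0%E.
Proof.
rewrite /expected_tosses; apply: integral0_eq => w _.
apply/eqP; rewrite eq_le; apply/andP; split.
  by apply: ereal_inf_lbound; exists 0%N => //=; rewrite cardfs1.
by apply: le_ereal_inf_tmp => _ [t _ <-]; rewrite lee_fin ler0n.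
Qed.

(* Main.v *)
Require Import Defs.
From HB Require Import structures.
From mathcomp Require Import all_boot all_order all_algebra finmap.
From mathcomp Require Import zify ring.
From mathcomp Require Import all_classical all_reals all_analysis.
From mathcomp Require Import measurable_realfun.

Set Implicit Arguments.
Unset Strict Implicit.
Unset Printing Implicit Defensive.

Import Order.TTheory GRing.Theory Num.Theory.
Import numFieldNormedType.Exports.
Local Open Scope classical_set_scope.
Local Open Scope ring_scope.

(** The aggregate is always an interval $]-i, j[$. By gambler's ruin a particle
    released at the origin uses $ij$ tosses on average and leaves on the left
    with probability $j/(i+j)$. So if the expected number of tosses still needed
    when a particle is released is sought in the form
    $\alpha_m ij + \beta_m$ with $m = i + j$, one gets
    $\alpha_m = 1 + \alpha_{m+1}(1 - 2/m)$ and
    $\beta_m = m\alpha_{m+1} + \beta_{m+1}$, with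
    $\alpha_{n+1} = \beta_{n+1} = 0$; this is solved explicitly. Interpolating inside the interval gives a bounded
    nonnegative function of the full state which decreases by $1$ in mean at
    each toss until $n$ sites are occupied. Telescoping bounds the sums of the
    probabilities that the process is unfinished at time $t$; hence these
    probabilities tend to $0$, the remainder of the telescoping sum vanishes in
    the limit, and the expectation is the initial value of the function. *)

(** * Reduction of the aggregate to an interval *)

(* The occupied sites are the integers strictly between [- left] and [right],
   and the particle stands at [pos - left]. *)
Record interval_state := IntervalState { left : nat; right : nat; pos : nat }.

Definition interval_init := IntervalState 1 1 1.

Definition interval_step (s : interval_state) (b : bool) : interval_state :=
  let: IntervalState i j p := s in
  if b then (if p.+1 == i + j then IntervalState i j.+1 i
             else IntervalState i j p.+1)%N
  else (if p == 1 then IntervalState i.+1 j i.+1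
        else IntervalState i j p.-1)%N.

Definition interval_wf (s : interval_state) : bool :=
  [&& 0 < left s, 0 < right s, 0 < pos s & pos s < left s + right s]%N.

(** Membership already determines the cardinality; carrying it as an invariant avoids counting the
    integers of an interval. *)
Definition represents (s : idla_state) (u : interval_state) : Prop :=
  [/\ interval_wf u, position s = (pos u)%:Z - (left u)%:Z,
      forall y, (y \in occupied s) = (- (left u)%:Z < y < (right u)%:Z) &
      (#|` occupied s|).+1 = (left u + right u)%N].

Lemma interval_step_wf s b : interval_wf s -> interval_wf (interval_step s b).
Proof.
case: s => i j p; rewrite /interval_wf /=.
by case: b; case: eqP => /=; lia.
Qed.

Lemma represents_init : represents idla_init interval_init.
Proof.
split=> //=; last by rewrite cardfs1.
by move=> y; rewrite in_fset1; apply/idP/idP; lia.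
Qed.

Lemma represents_step s u b :
  represents s u -> represents (idla_step s b) (interval_step u b).
Proof.
case: s u => O x [i j p] [wf /= xE memO cardO].
split; first exact: (interval_step_wf b wf).
all: move: wf; rewrite /interval_wf /=.
- rewrite /idla_step /= memO.
  by case: b; case: eqP => /= ? wf; case: ifP => /=; lia.
- move=> wf y; rewrite /idla_step /= memO.
  case: b; case: eqP => /= h; case: ifP => /= hx;
    rewrite ?in_fset1U ?memO; lia.
- rewrite /idla_step /= => wf.
  by case: b; case: eqP => /= h; case: ifP => /= hx;
    rewrite ?cardfsU1 ?hx /=; rewrite memO in hx; lia.
Qed.

Lemma represents_foldl s u v : represents s u ->
  represents (foldl idla_step s v) (foldl interval_step u v).
Proof. by elim: v s u => //= b v IHv s u /(@represents_step _ _ b)/IHv. Qed.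

Lemma idla_foldl w t : idla w t = foldl idla_step idla_init (mkseq w t).
Proof. by elim: t => [//|t IHt]; rewrite mkseqS foldl_rcons -IHt. Qed.

Definition interval_idla w t := foldl interval_step interval_init (mkseq w t).

Lemma card_idla w t :
  (#|` occupied (idla w t)|).+1 =
  (left (interval_idla w t) + right (interval_idla w t))%N.
Proof.
by rewrite idla_foldl; have [] := represents_foldl (mkseq w t) represents_init.
Qed.

(** * Potential function and its drift *)

Section Potential.
Variables (R : realType) (n : nat).
Hypothesis n_gt1 : (1 < n)%N.

(* [alpha] and [beta] are the explicit solutions of the recursion; the term
   [l = n] of [beta] is zero and is left out of the sum. *)
Definition alpha (m : nat) : R :=
  (m%:R - 1) * (n%:R + 1 - m%:R) / (n%:R - 1).
Definition beta (m : nat) : R :=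
  \sum_(m <= l < n) l%:R ^+ 2 * (n%:R - l%:R) / (n%:R - 1).
Definition value i j : R := alpha (i + j) * (i%:R * j%:R) + beta (i + j).

(* [p] and [i + j - p] are the distances from the particle to the two nearest
   unoccupied sites. *)
Definition walk_value i j (p : nat) : R :=
  p%:R * (i%:R + j%:R - p%:R) +
  ((i%:R + j%:R - p%:R) * value i.+1 j + p%:R * value i j.+1) / (i%:R + j%:R).

(** The interval has [left + right - 1] sites, so the bound says that fewer than [n] are
    occupied. *)
Definition unfinished (s : interval_state) := (left s + right s <= n)%N.

Definition potential (s : interval_state) : R :=
  if unfinished s then walk_value (left s) (right s) (pos s) else 0.

Let n1_neq0 : n%:R - 1 != 0 :> R.
Proof. by rewrite subr_eq0 (eqr_nat R n 1); lia. Qed.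

Lemma beta_rec m : (m <= n)%N ->
  beta m = m%:R ^+ 2 * (n%:R - m%:R) / (n%:R - 1) + beta m.+1.
Proof.
rewrite leq_eqVlt => /orP[/eqP ->|lt_mn]; last by rewrite /beta big_ltn.
by rewrite /beta subrr mulr0 mul0r add0r !big_geq.
Qed.

(** The ansatz closes up because [(i+1) j^2 + i^2 (j+1) = m i j + m^2 - 2 i j] with [m = i + j]: the
    average of the two products is again affine in [i j]. *)
Lemma value_rec i j : (0 < i)%N -> (0 < j)%N -> (i + j <= n)%N ->
  value i j = walk_value i j i.
Proof.
move=> i0 j0 le_n.
have : i%:R + j%:R != 0 :> R by rewrite -natrD pnatr_eq0; lia.
rewrite /walk_value /value addSn addnS (beta_rec le_n) /alpha.
rewrite !natrD -!natr1 natrD.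
by move: n1_neq0 => n1 m0; field; rewrite n1 m0.
Qed.

Lemma value_end i j : (i + j = n.+1)%N -> value i j = 0.
Proof.
move=> h; rewrite /value /alpha /beta h big_geq //.
by rewrite -natr1 subrr mulr0 !mul0r addr0.
Qed.

(** The quadratic term has second difference [-2] in [p], and the interpolation term is affine in
    [p]. *)
Lemma walk_value_harmonic i j p : (0 < i)%N ->
  walk_value i j p.+1 = 1 + (walk_value i j p.+2 + walk_value i j p) / 2.
Proof.
move=> i0; have : i%:R + j%:R != 0 :> R by rewrite -natrD pnatr_eq0; lia.
by rewrite /walk_value -!natr1 => m0; field.
Qed.

(** Including [i + j = n.+1], where both sides vanish, lets the last settlement be treated like the
    others. *)
Lemma potential_origin i j : (0 < i)%N -> (0 < j)%N -> (i + j <= n.+1)%N ->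
  potential (IntervalState i j i) = value i j.
Proof.
move=> i0 j0 le_n; rewrite /potential /unfinished /=; case: leqP => h.
  by rewrite value_rec.
by rewrite value_end //; lia.
Qed.

(** At the unoccupied sites [p = 0] and [p = i + j], [walk_value] equals [value] of the enlarged
    interval, so settling and walking both reduce to harmonicity. *)
Lemma potential_step s : interval_wf s ->
  potential s = (unfinished s)%:R +
    (potential (interval_step s true) + potential (interval_step s false)) / 2.
Proof.
case: s => i j p; rewrite /interval_wf [X in X -> _]/= => wf.
case: (leqP (i + j) n) => h; last first.
  have stop b : unfinished (interval_step (IntervalState i j p) b) = false.
    by rewrite /unfinished; case: b => /=; case: eqP => /= _; lia.
  have stop0 : unfinished (IntervalState i j p) = false.
    by rewrite /unfinished /=; lia.
  by rewrite /potential !stop stop0 add0r addr0 mul0r.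
have m0 : i%:R + j%:R != 0 :> R by rewrite -natrD pnatr_eq0; lia.
have -> : unfinished (IntervalState i j p) by [].
have -> : potential (interval_step (IntervalState i j p) true) =
          walk_value i j p.+1.
  rewrite /=; case: eqP => pE.
    rewrite potential_origin; try lia.
    by rewrite pE /walk_value natrD; field.
  by rewrite /potential /unfinished /= h.
have -> : potential (interval_step (IntervalState i j p) false) =
          walk_value i j p.-1.
  rewrite /=; case: eqP => pE.
    rewrite potential_origin; try lia.
    by rewrite pE /walk_value /=; field.
  by rewrite /potential /unfinished /= h.
case: p wf => [|p] wf; first by lia.
rewrite /potential /unfinished /= h.
by apply: walk_value_harmonic; lia.
Qed.

Lemma value_ge0 i j : (0 < i)%N -> (i + j <= n.+1)%N -> 0 <= value i j.
Proof.
move=> i0 le_n; have n1 : 0 <= n%:R - 1 :> R by rewrite subr_ge0 ler1n; lia.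
apply: addr_ge0.
  apply: mulr_ge0; last by rewrite mulr_ge0 ?ler0n.
  apply: divr_ge0 => //; apply: mulr_ge0.
    by rewrite subr_ge0 ler1n; lia.
  by rewrite subr_ge0 natr1 ler_nat.
rewrite /beta big_nat; apply: sumr_ge0 => l /andP[_ ln].
apply: divr_ge0 => //; apply: mulr_ge0; first exact: sqr_ge0.
by rewrite subr_ge0 ler_nat ltnW.
Qed.

Lemma potential_ge0 s : interval_wf s -> 0 <= potential s.
Proof.
case: s => i j p; rewrite /interval_wf /potential /unfinished /= => wf.
case: leqP => // h.
have q0 : 0 <= i%:R + j%:R - p%:R :> R.
  by rewrite subr_ge0 -natrD ler_nat; lia.
apply: addr_ge0; first by rewrite mulr_ge0.
by rewrite divr_ge0 ?addr_ge0 ?mulr_ge0 ?ler0n ?value_ge0 //; lia.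
Qed.

Lemma potential_le : exists C,
  forall s, interval_wf s -> potential s <= C * (unfinished s)%:R.
Proof.
(* Unfinished well-formed states lie in this finite box, so the sum bounds each of their values. *)
exists (\sum_(i < n.+1) \sum_(j < n.+1) \sum_(p < n.+1) `|walk_value i j p|).
case=> i j p; rewrite /interval_wf /potential /unfinished /= => wf.
case: leqP => // h; last by rewrite mulr0.
have [hi hj hp] : [/\ i < n.+1, j < n.+1 & p < n.+1]%N by split; lia.
rewrite mulr1 (bigD1 (Ordinal hi)) //= (bigD1 (Ordinal hj)) //=.
rewrite (bigD1 (Ordinal hp)) //= -!addrA.
apply: le_trans (ler_norm _) _; rewrite lerDl.
by do !(apply: addr_ge0 || (apply: sumr_ge0 => ? _) || apply: normr_ge0).
Qed.

(** Sums of squares and cubes; [c] stays independent of [k] for the induction and becomes [n]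
    afterwards. *)
Lemma sum_sqr_mulB (c : R) k :
  \sum_(0 <= l < k) l%:R ^+ 2 * (c - l%:R) =
  c * (k%:R - 1) * k%:R * (2 * k%:R - 1) / 6 - (k%:R * (k%:R - 1) / 2) ^+ 2.
Proof.
elim: k => [|k IHk]; first by rewrite big_geq //; field.
by rewrite big_nat_recr //= IHk -natr1; field.
Qed.

Lemma potential_init :
  potential interval_init = 1 / 12 * n%:R ^+ 3 + 1 / 12 * n%:R ^+ 2.
Proof.
(* [alpha 2 = 1] is the missing term [l = 1] of the sum, and the term [l = 0] is zero. *)
have -> : potential interval_init = beta 0.
  rewrite potential_origin //; last exact: leqW.
  rewrite (beta_rec (leq0n n)) (beta_rec (ltnW n_gt1)) /value /alpha.
  by rewrite (_ : (1 + 1 = 2)%N) //; field.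
rewrite (_ : beta 0 = (\sum_(0 <= l < n) l%:R ^+ 2 * (n%:R - l%:R)) /
                      (n%:R - 1)); last by rewrite mulr_suml.
rewrite sum_sqr_mulB.
by field.
Qed.

(** * Averages over coin tosses and telescoping *)

(** The mean of [f] after [t] fair tosses from [s], by conditioning on the first toss; no
    probability space is involved yet. *)
Fixpoint coin_averages t f s : R :=
  if t is t'.+1 then
    (coin_averages t' f (interval_step s true) +
     coin_averages t' f (interval_step s false)) / 2
  else f s.

Definition survival t s := coin_averages t (fun u => (unfinished u)%:R) s.

Lemma coin_averages_ge0 t f s : (forall u, interval_wf u -> 0 <= f u) ->
  interval_wf s -> 0 <= coin_averages t f s.
Proof.
move=> f0; elim: t s => [|t IHt] s wf; first exact: f0.
by rewrite /= divr_ge0 ?addr_ge0 ?IHt ?interval_step_wf.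
Qed.

Lemma coin_averages_potential t s : interval_wf s ->
  coin_averages t potential s =
  survival t s + coin_averages t.+1 potential s.
Proof.
elim: t s => [|t IHt] s wf; first exact: potential_step.
have IHs b := IHt _ (interval_step_wf b wf).
by rewrite [LHS]/= (IHs true) (IHs false) /survival /=; field.
Qed.

Lemma coin_averages_potential_le : exists C,
  forall t s, interval_wf s -> coin_averages t potential s <= C * survival t s.
Proof.
have [C hC] := potential_le; exists C.
elim=> [|t IHt] s wf; first exact: hC.
rewrite /survival /= mulrA mulrDr ler_pM2r ?invr_gt0 //.
by apply: lerD; apply: IHt; apply: interval_step_wf.
Qed.

Lemma sum_survival t s : interval_wf s ->
  \sum_(0 <= k < t) survival k s = potential s - coin_averages t potential s.
Proof.
move=> wf; elim: t => [|t IHt]; first by rewrite big_geq // subrr.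
rewrite big_nat_recr //= IHt (coin_averages_potential t) //=; ring.
Qed.

Lemma cvg_sum_survival s : interval_wf s ->
  series (survival ^~ s) @ \oo --> potential s.
Proof.
move=> wf.
have surv0 t : 0 <= survival t s by apply: coin_averages_ge0.
have pot0 t : 0 <= coin_averages t potential s.
  by apply: coin_averages_ge0 => //; exact: potential_ge0.
have serE t : series (survival ^~ s) t =
    potential s - coin_averages t potential s by exact: sum_survival.
have cvg_ser : cvgn (series (survival ^~ s)).
  apply: nondecreasing_is_cvgn.
    apply/nondecreasing_seqP => t; rewrite !seriesEnat /= big_nat_recr //=.
    by rewrite lerDl.
  by exists (potential s) => _ [t _ <-]; rewrite serE gerBl.
have surv_cvg0 := cvg_series_cvg_0 cvg_ser.
have [C hC] := coin_averages_potential_le.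
have pot_cvg0 : coin_averages t potential s @[t --> \oo] --> (0:R).
  apply: (@squeeze_cvgr _ _ _ _ (fun=> 0) (fun t => C * survival t s)).
  - by near=> t; rewrite pot0 hC.
  - exact: cvg_cst.
  - by rewrite -[X in _ --> X](mulr0 C); apply: cvgM => //; exact: cvg_cst.
rewrite (_ : series _ = fun t => potential s - coin_averages t potential s).
  rewrite -[X in _ --> X]subr0; apply: cvgB => //; exact: cvg_cst.
by apply/funext.
Unshelve. all: by end_near. Qed.

End Potential.

(** * The stopping time as a series of indicators *)

Section TossesUntil.
Variables (n : nat) (w : nat -> bool).
Hypothesis n_gt0 : (0 < n)%N.

Definition aggregate_size t := #|` occupied (idla w t)|.

Lemma aggregate_size0 : aggregate_size 0 = 1%N.
Proof. by rewrite /aggregate_size /= cardfs1. Qed.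

Lemma aggregate_sizeS t :
  (aggregate_size t <= aggregate_size t.+1 <= (aggregate_size t).+1)%N.
Proof.
rewrite /aggregate_size /= /idla_step; case: ifP => [_|x_notin] /=.
  by rewrite leqnn leqnSn.
by rewrite cardfsU1 x_notin add1n leqnSn leqnn.
Qed.

Lemma aggregate_size_homo : {homo aggregate_size : s t / (s <= t)%N}.
Proof.
apply: homo_leq => [//|? ? ? /leq_trans|t]; first exact.
by have /andP[] := aggregate_sizeS t.
Qed.

Lemma unfinished_interval_idla t :
  unfinished n (interval_idla w t) = (aggregate_size t < n)%N.
Proof. by rewrite /unfinished -card_idla. Qed.

(* The stopping time is the number of times at which the aggregate is still
   too small, because the number of sites starts at [1 <= n] and cannot jump
   over [n]. *)
Lemma tosses_untilE (R : realType) : tosses_until R n w =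
  (\sum_(0 <= t <oo) (unfinished n (interval_idla w t))%:R%:E)%E.
Proof.
under eq_eseriesr do rewrite unfinished_interval_idla.
have before t :
    (forall s, (s <= t)%N -> aggregate_size s != n) -> (aggregate_size t < n)%N.
  elim: t => [|t IHt] neq.
    by have := neq 0%N isT; rewrite aggregate_size0; lia.
  have := IHt (fun s le_st => neq s (leqW le_st)).
  by have := aggregate_sizeS t; have := neq t.+1 (leqnn _); lia.
have [reached|never] := pselect (exists t, aggregate_size t == n).
  case: (ex_minnP reached) => t /eqP ct tmin.
  (* By monotonicity and minimality of [t], the terms are 1 before [t] and 0 from [t] on. *)
  have lt_t s : (aggregate_size s < n)%N = (s < t)%N.
    apply/idP/idP => [|lt_st].
      by apply: contraTT; rewrite -!leqNgt -ct; exact: aggregate_size_homo.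
    apply: before => r le_rs; apply/eqP => /eqP /tmin; lia.
  rewrite (nneseries_split 0 t); last by move=> s _; rewrite lee_fin ler0n.
  rewrite add0n eseries0 ?adde0; last first.
    by move=> s le_ts _; rewrite lt_t ltnNge le_ts.
  rewrite big_nat (eq_bigr (fun=> 1%:E)); last first.
    by move=> s /andP[_ lt_st]; rewrite lt_t lt_st.
  rewrite -big_nat sumEFin big_const_nat subn0 iter_addr_0.
  apply/eqP; rewrite eq_le; apply/andP; split.
    by apply: ereal_inf_lbound; exists t.
  apply: le_ereal_inf_tmp => _ [s /= cs <-]; rewrite lee_fin ler_nat.
  by apply: tmin; rewrite /aggregate_size cs.
(* If size [n] is never reached, the infimum over the empty set is [+oo], and the series of ones
   exceeds every real. *)
have small t : (aggregate_size t < n)%N.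
  by apply: before => s _; apply/negP => cs; apply: never; exists s.
rewrite /tosses_until (_ : [set t | _] = set0); last first.
  apply/seteqP; split=> // t /= ct.
  by have := small t; rewrite /aggregate_size ct ltnn.
rewrite image_set0 ereal_inf0; apply/esym/eqyP => A A0.
have [k Ak] : exists k : nat, A <= k%:R.
  by exists (Num.bound A); apply: ltW; apply: archi_boundP; exact: ltW.
apply: (@le_trans _ _ k%:R%:E); first by rewrite lee_fin.
apply: le_trans (nneseries_lim_ge k _); last by move=> *; rewrite lee_fin ler0n.
rewrite (eq_bigr (fun=> 1%:E)); last by move=> s _; rewrite small.
by rewrite sumEFin big_const_nat subn0 iter_addr_0.
Qed.

End TossesUntil.

(** * Probabilities of finite coin words *)

Section CoinTosses.
Variables (d : measure_display) (T : measurableType d) (R : realType).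
Variables (P : probability T R) (X : nat -> {RV P >-> bool}).
Hypothesis hX : fair_coin_tosses X.

Definition tosses (w : T) (k : nat) : bool := X k w.

Definition prefix_event (v : seq bool) : set T :=
  [set w | mkseq (tosses w) (size v) = v].

Lemma fair_coin_tossE k b : P (X k @^-1` [set b]) = (2^-1)%:E.
Proof.
case: b; first by have [_ ->] := hX.
rewrite (_ : _ @^-1` _ = ~` (X k @^-1` [set true])); last first.
  by apply/seteqP; split=> w /=; case: (X k w).
rewrite probability_setC; last exact: measurable_funPTI.
have [_ ->] := hX; rewrite -EFinB; congr EFin.
by field.
Qed.

Lemma prefix_eventE v : prefix_event v =
  \bigcap_(i in [set` seq_fset tt (iota 0 (size v))])
    (X i @^-1` [set nth false v i]).
Proof.
have memJ i : (i \in seq_fset tt (iota 0 (size v))) = (i < size v)%N.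
  by rewrite seq_fsetE mem_iota.
move: (seq_fset _ _) memJ => J memJ; apply/seteqP; split=> w.
  by move=> wv i /=; rewrite memJ -[in RHS]wv => iv; rewrite nth_mkseq.
move=> wv; apply: (@eq_from_nth _ false); rewrite size_mkseq // => i iv.
by rewrite nth_mkseq //; apply: wv; rewrite /= memJ.
Qed.

Lemma measurable_prefix_event v : measurable (prefix_event v).
Proof.
rewrite prefix_eventE; apply: fin_bigcap_measurable => [|i _].
  exact: finite_fset.
exact: measurable_funPTI.
Qed.

Lemma prefix_event_prob v : P (prefix_event v) = (2^-1 ^+ size v)%:E.
Proof.
have [indep _] := hX; rewrite prefix_eventE indep //.
rewrite (eq_bigr (fun=> (2^-1)%:E)) => [|i _]; last exact: fair_coin_tossE.
rewrite prodEFin big_const_seq count_predT iter_mulr_1.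
by rewrite size_seq_fset undup_id ?iota_uniq // size_iota.
Qed.

(** Interpolates between a pure cylinder ([t = 0]) and the event of being unfinished at time [t]
    ([v] empty). *)
Definition word_event v t n : set T :=
  prefix_event v `&`
  [set w | unfinished n (interval_idla (tosses w) (size v + t))].

Lemma word_event_split v t n :
  word_event v t.+1 n =
  word_event (rcons v true) t n `|` word_event (rcons v false) t n.
Proof.
rewrite /word_event /prefix_event !size_rcons !addSnnS.
apply/seteqP; split=> w /=.
  rewrite !mkseqS => -[-> fin].
  by case: (tosses w (size v)); [left|right].
by rewrite !mkseqS => -[] [/rcons_inj [-> _]].
Qed.

(** Splitting on the toss after [v] matches the recursion of [survival]: the factor [1/2] of the
    average becomes that of the longer prefix. *)
Lemma word_event_prob v t n : measurable (word_event v t n) /\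
  P (word_event v t n) =
    (2^-1 ^+ size v * survival R n t
      (foldl interval_step interval_init v))%:E.
Proof.
elim: t v => [|t IHt] v.
  rewrite /survival /=; set u := foldl _ _ _.
  have idlaE w : prefix_event v w -> interval_idla (tosses w) (size v + 0) = u.
    by rewrite addn0 /interval_idla => ->.
  case: (boolP (unfinished n u)) => fin.
    rewrite (_ : word_event _ _ _ = prefix_event v); last first.
      by apply/seteqP; split=> w /= => [[]|pw] //; split=> //=; rewrite idlaE.
    rewrite mulr1; split; first exact: measurable_prefix_event.
    exact: prefix_event_prob.
  rewrite (_ : word_event _ _ _ = set0); last first.
    by apply/seteqP; split=> w //= [pw] /=; rewrite idlaE // (negbTE fin).
  by rewrite mulr0 measure0.
have [mt Pt] := IHt (rcons v true); have [mf Pf] := IHt (rcons v false).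
rewrite word_event_split; split; first exact: measurableU.
have -> : P (word_event (rcons v true) t n `|`
             word_event (rcons v false) t n) =
    (P (word_event (rcons v true) t n) + P (word_event (rcons v false) t n))%E.
  apply: measureU => //.
  apply/seteqP; split=> w //= [[+ _] [+ _]]; rewrite /prefix_event /=.
  by rewrite !size_rcons => -> /rcons_inj [].
rewrite Pt Pf -EFinD !size_rcons !foldl_rcons /survival /= exprSr.
congr EFin.
by field.
Qed.

Lemma expected_tossesE n : (0 < n)%N -> expected_tosses X n =
  (\sum_(0 <= t <oo) (survival R n t interval_init)%:E)%E.
Proof.
move=> n_gt0; rewrite /expected_tosses.
have eventE w t : (unfinished n (interval_idla (tosses w) t))%:R =
    \1_(word_event [::] t n) w :> R.
  rewrite indicE; congr (nat_of_bool _)%:R.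
  by apply/idP/idP => [h|]; [rewrite inE; split|rewrite inE => -[]].
rewrite (eq_integral (fun w =>
  \sum_(0 <= t <oo) (\1_(word_event [::] t n) w)%:E)%E); last first.
  move=> w _; rewrite tosses_untilE //; apply: eq_eseriesr => t _.
  by rewrite -eventE.
(* Monotone convergence exchanges the integral and the series of nonnegative terms. *)
rewrite integral_nneseries //; last first.
  move=> t; apply/measurable_EFinP; apply: measurable_indic.
  by have [] := word_event_prob [::] t n.
apply: eq_eseriesr => t _; have [me Pe] := word_event_prob [::] t n.
transitivity (P (word_event [::] t n)); last by rewrite Pe expr0 mul1r.
by rewrite integral_indic // setIT.
Qed.

End CoinTosses.

Theorem theorem2 (d : measure_display) (T : measurableType d) (R : realType)
    (P : probability T R) (X : nat -> {RV P >-> bool})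
    (hX : fair_coin_tosses X) (n : nat) (hn : (2 <= n)%N) :
  expected_tosses X n = (1 / 12 * n%:R ^+ 3 + 1 / 12 * n%:R ^+ 2)%:E.
Proof.
rewrite (expected_tossesE hX) ?(ltnW hn) // -(potential_init R hn).
have cvg_pot := @cvg_sum_survival R n hn interval_init isT.
(* The real limit is transferred to the extended reals, where the series of [expected_tossesE]
   lives. *)
rewrite -(cvg_lim (@Rhausdorff R) cvg_pot) -EFin_lim; last first.
  by apply/cvg_ex; exists (potential R n interval_init).
by apply: congr_lim; apply/funext => t /=; rewrite sumEFin.
Qed.
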